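(* Let $p,q\in\mathbb{Z}_+$. Let $C_0,\ldots,C_p$ and $D_0,\ldots,D_q$ be two families of closed linear operators from $H$ to $H'$ (with domains in $H$) such that each of the two families $(T_j)=(C_j)_{j=0}^p$ and $(T_j)=(D_j)_{j=0}^q$ satisfies: every $e_n$, $n\in M$, lies in the domain of every $T_j$; $(T_je_{n'},T_je_{n''})_{H'}=0$ for every $j$ and all $n'\neq n''$ in $M$; and $T_{j_0}e_{n_0}\neq0$ for some $j_0$ and some $n_0\in M$. Let $X$ be a normed space over $\mathbb{C}$, $A:H\to X$ a linear operator with domain $\mathcal{D}(A)\subset H$, and $f\in X^*$ a bounded linear functional such that: $e_n\in\mathcal{D}(A)$ for every $n\in M$; $\langle f,Ae_{n_0}\rangle\neq0$ for some $n_0\in M$; and the functional $g_f(x)=\langle f,Ax\rangle$ from $H$ to $\mathbb{C}$ with domain $\mathcal{D}(A)$ is closable. Assume that $$\widetilde{\sum_{n\in M}}\frac{|\langle f,Ae_n\rangle|^2}{b_{n,\mathbf{1}}}<\infty .$$ Then for all $\mathbf{h}'\in\mathbb{R}_+^{p+1}$, $\mathbf{h}''\in\mathbb{R}_+^{q+1}$ and $x\in\mathcal{D}(A)\cap H_{\mathbf{B}}$ the following sharp inequality holds: $$|\langle f,Ax\rangle|\leqslant\left(\widetilde{\sum_{n\in M}}\frac{|\langle f,Ae_n\rangle|^2c_{n,\mathbf{h}'}}{b_{n,\mathbf{h}}^2}\right)^{1/2}\|x\|_{\mathbf{C},\mathbf{h}'}+\left(\widetilde{\sum_{n\in M}}\frac{|\langle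 f,Ae_n\rangle|^2d_{n,\mathbf{h}''}}{b_{n,\mathbf{h}}^2}\right)^{1/2}\|x\|_{\mathbf{D},\mathbf{h}''} .$$ The sequence $x_{\mathbf{h},N}:=\widetilde{\sum}_{n\in M_N}\frac{\overline{\langle f,Ae_n\rangle}}{b_{n,\mathbf{h}}}e_n$, $N\in\mathbb{N}$, is extremal in this inequality, i.e. along it the ratio of the left-hand side to the right-hand side tends to $1$ as $N\to\infty$.
   Context: $\mathbb{R}_+=(0,+\infty)$; $\mathbb{Z}_+$ is the set of non-negative integers; $\mathbf{1}=(1,\ldots,1)$. $H$ is a separable Hilbert space over $\mathbb{C}$ with orthonormal basis $\{e_n\}_{n\in M}$, $M$ finite or countable; $x_n:=(x,e_n)_H$. $\{M_N\}_{N=1}^\infty$ is a fixed sequence of nested finite subsets of $M$ with union $M$, and $\sum_{n\in M}a_n:=\lim_{N\to\infty}\sum_{n\in M_N}a_n$. $H'$ is a Hilbert space over $\mathbb{C}$. For non-negative sequences $\{a_n\},\{b_n\}$, the sum $\widetilde{\sum}_{n\in M}\frac{a_n}{b_n}$ equals $+\infty$ if there is $n_0$ with $a_{n_0}\neq0$ and $b_{n_0}=0$, and otherwise equals $\sum_{n\in M:\,b_n\neq0}\frac{a_n}{b_n}$ (an empty sum is $0$). In $\widetilde{\sum}$ with vector terms, the terms with zero numerator and zero denominator are likewise omitted. For $\mathbf{h}'=(h_0',\ldots,h_p')\in\mathbb{R}_+^{p+1}$ and $\mathbf{h}''=(h_0'',\ldots,h_q'')\in\mathbb{R}_+^{q+1}$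 put $c_{n,\mathbf{h}'}:=\sum_{j=0}^p h_j'\|C_je_n\|_{H'}^2$, $d_{n,\mathbf{h}''}:=\sum_{j=0}^q h_j''\|D_je_n\|_{H'}^2$, $b_{n,\mathbf{h}}:=c_{n,\mathbf{h}'}+d_{n,\mathbf{h}''}$ with $\mathbf{h}=(\mathbf{h}',\mathbf{h}'')$ (so $b_{n,\mathbf{1}}=c_{n,\mathbf{1}}+d_{n,\mathbf{1}}$). $H_{\mathbf{C}}:=\{x\in H:\sum_{n}|x_n|^2\|C_je_n\|_{H'}^2<\infty,\ j=0,\ldots,p\}$ with seminorm $\|x\|_{\mathbf{C},\mathbf{h}'}:=(\sum_n|x_n|^2c_{n,\mathbf{h}'})^{1/2}$; $H_{\mathbf{D}}$ and $\|x\|_{\mathbf{D},\mathbf{h}''}:=(\sum_n|x_n|^2d_{n,\mathbf{h}''})^{1/2}$ are defined in the same way from the $D_j$; $H_{\mathbf{B}}:=H_{\mathbf{C}}\cap H_{\mathbf{D}}$. An operator is closable if the closure of its graph is the graph of an operator. *)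

(* Defs.v *)
From HB Require Import structures.
From mathcomp Require Import all_boot all_order all_algebra.
From mathcomp Require Import finmap complex.
From mathcomp Require Import all_classical all_reals all_analysis.

Set Implicit Arguments.
Unset Strict Implicit.
Unset Printing Implicit Defensive.

Import Order.TTheory GRing.Theory Num.Theory.
Import numFieldNormedType.Exports.

Local Open Scope classical_set_scope.
Local Open Scope ring_scope.

(* The norm of a normed space over R[i] takes its values in R[i]; this is the
   same number as an element of R. *)
Definition rnorm (R : realType) (V : normedZmodType R[i]) (v : V) : R :=
  complex.Re `|v|.

(* Partially defined linear operators; the values of the underlying function
   outside the domain are irrelevant. *)
Record linop (K : numFieldType) (U V : normedModType K) := LinOp {
  dom : set U;
  app :> U -> V;
  dom0 : dom 0;
  dom_linear : forall (a : K) (x y : U), dom x -> dom y -> dom (a *: x + y);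
  app_linear : forall (a : K) (x y : U), dom x -> dom y ->
    app (a *: x + y) = a *: app x + app y
}.

Definition graph (K : numFieldType) (U V : normedModType K)
  (T : linop U V) : set (U * V) := [set z | dom T z.1 /\ z.2 = T z.1].

Definition closed_op (K : numFieldType) (U V : normedModType K)
  (T : linop U V) : Prop := closed (graph T).

Definition closable (K : numFieldType) (U V : normedModType K)
  (T : linop U V) : Prop := exists S : linop U V, closure (graph T) = graph S.

Lemma lcomp_linear (K : numFieldType) (U V W : normedModType K)
  (f : {linear V -> W}) (A : linop U V) (a : K) (x y : U) :
  dom A x -> dom A y -> f (A (a *: x + y)) = a *: f (A x) + f (A y).
Proof. by move=> Ax Ay; rewrite app_linear// linearP. Qed.

Definition lcomp (K : numFieldType) (U V W : normedModType K)
    (f : {linear V -> W}) (A : linop U V) : linop U W :=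
  {| dom := dom A; app := fun x => f (A x); dom0 := dom0 A;
     dom_linear := @dom_linear _ _ _ A;
     app_linear := @lcomp_linear _ _ _ _ f A |}.

(* A complete normed space whose norm comes from the inner product [ip]
   (linear in the first argument) is a Hilbert space. *)
Definition induces_norm (R : realType) (H : normedModType R[i])
  (ip : {dot H for @Num.conj R[i]}) : Prop :=
  forall x : H, `|x| ^+ 2 = ip x x.

Definition orthonormal_basis (R : realType) (H : normedModType R[i])
    (ip : {dot H for @Num.conj R[i]}) (M : countType) (e : M -> H) : Prop :=
  (forall m n : M, ip (e m) (e n) = (m == n)%:R) /\
  closure [set x | exists (S : {fset M}) (a : M -> R[i]),
                     x = \sum_(n <- S) a n *: e n] = [set: H].

Definition exhaustion (M : countType) (MN : nat -> {fset M}) : Prop :=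
  (forall N : nat, (MN N `<=` MN N.+1)%fset) /\
  (forall n : M, exists N : nat, n \in MN N).

Definition msum (R : realType) (M : countType) (MN : nat -> {fset M})
  (a : M -> R) : \bar R := limn (fun N => (\sum_(n <- MN N) a n)%:E).

Definition tsum (R : realType) (M : countType) (MN : nat -> {fset M})
    (a b : M -> R) : \bar R :=
  if `[< exists n : M, a n <> 0 /\ b n = 0 >] then +oo%E
  else limn (fun N => (\sum_(n <- MN N | b n != 0) a n / b n)%:E).

Definition tsum_vec (R : realType) (H : normedModType R[i]) (M : countType)
    (S : {fset M}) (a : M -> R[i]) (b : M -> R) (e : M -> H) : H :=
  \sum_(n <- S | b n != 0) (a n / (b n)%:C%C) *: e n.

Definition family_cond (R : realType) (H H' : normedModType R[i])
    (ip' : {dot H' for @Num.conj R[i]}) (M : countType) (e : M -> H)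
    (p : nat) (T : 'I_p.+1 -> linop H H') : Prop :=
  [/\ forall (n : M) (j : 'I_p.+1), dom (T j) (e n),
      forall (j : 'I_p.+1) (n1 n2 : M), n1 <> n2 ->
        ip' (T j (e n1)) (T j (e n2)) = 0
    & exists (j0 : 'I_p.+1) (n0 : M), T j0 (e n0) <> 0].

Definition weight (R : realType) (H H' : normedModType R[i]) (M : countType)
    (e : M -> H) (p : nat) (T : 'I_p.+1 -> linop H H') (h : 'I_p.+1 -> R)
    (n : M) : R :=
  \sum_(j < p.+1) h j * rnorm (T j (e n)) ^+ 2.

Definition wspace (R : realType) (H H' : normedModType R[i])
    (ip : {dot H for @Num.conj R[i]}) (M : countType) (MN : nat -> {fset M})
    (e : M -> H) (p : nat) (T : 'I_p.+1 -> linop H H') : set H :=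
  [set x | forall j : 'I_p.+1,
     (msum MN (fun n => rnorm (ip x (e n)) ^+ 2 * rnorm (T j (e n)) ^+ 2)%R
        < +oo)%E].

Definition wseminorm (R : realType) (H H' : normedModType R[i])
    (ip : {dot H for @Num.conj R[i]}) (M : countType) (MN : nat -> {fset M})
    (e : M -> H) (p : nat) (T : 'I_p.+1 -> linop H H') (h : 'I_p.+1 -> R)
    (x : H) : \bar R :=
  poweR (msum MN (fun n => rnorm (ip x (e n)) ^+ 2 * weight e T h n)) 2^-1.

(* The constant 1 in the inequality lhs <= rhs on D cannot be decreased. *)
Definition sharp (R : realType) (H : Type) (D : set H) (lhs rhs : H -> \bar R)
  : Prop :=
  forall k : R, k < 1 -> exists2 x, D x & (k%:E * rhs x < lhs x)%E.

(* In [\bar R], r / +oo = 0, so the convergence entails that the right-hand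
   side is eventually finite. *)
Definition extremal (R : realType) (H : Type) (D : set H) (lhs rhs : H -> \bar R)
  (u : nat -> H) : Prop :=
  (forall N : nat, D (u N)) /\
  (lhs (u N) / rhs (u N))%E @[N --> \oo] --> 1%E.

(* Main.v *)
(* Closability of x |-> f(Ax), together with the absolute convergence of
   sum x_n f(A e_n), gives f(Ax) = sum x_n f(A e_n) on the weighted spaces,
   since the Fourier partial sums of x converge to x.  Writing
   |x_n f(A e_n)| = |x_n| |f(A e_n)| (c_n + d_n) / b_n and applying the
   Cauchy-Schwarz inequality to the c-part and to the d-part separately gives
   the bound.  For x_{h,N} the two vectors in each Cauchy-Schwarz inequality
   agree on M_N, so both sides tend to the same limit; sharpness follows. *)
Require Import Defs.
From HB Require Import structures.
From mathcomp Require Import all_boot all_order all_algebra.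
From mathcomp Require Import finmap complex.
From mathcomp Require Import all_classical all_reals all_analysis.
Import Order.TTheory GRing.Theory Num.Theory.
Import numFieldNormedType.Exports.
Local Open Scope classical_set_scope.
Local Open Scope ring_scope.
From mathcomp Require Import ring lra.
Set Implicit Arguments.
Unset Strict Implicit.
Unset Printing Implicit Defensive.
Local Notation msum := Defs.msum.

(** * Sums along a nested sequence of finite sets exhausting the index set *)

Lemma exhaustion_mono (M : countType) (MN : nat -> {fset M}) :
  exhaustion MN -> forall m n, (m <= n)%N -> (MN m `<=` MN n)%fset.
Proof.
move=> [sMN _] m n /subnK <-; elim: (n - m)%N => // k IH.
exact: fsubset_trans IH (sMN _).
Qed.

(** Induction on [S]: each point enters at some stage and, the sets being nested, never leaves, so
    the larger of two stages serves both. *)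
Lemma exhaustion_eventually (M : countType) (MN : nat -> {fset M})
    (S : {fset M}) : exhaustion MN ->
  exists N0, forall N, (N0 <= N)%N -> (S `<=` MN N)%fset.
Proof.
move=> exM; elim/finSet_rect: S => S IH.
have [->|[n nS]] := fset_0Vmem S; first by exists 0%N => N _; exact: fsub0set.
have [N0 SN0] := IH _ (fproperD1 nS).
have [N1 nN1] := exM.2 n.
exists (maxn N0 N1) => N; rewrite geq_max => /andP[N0N N1N].
rewrite -(fsetD1K nS) fsubUset fsub1set (SN0 _ N0N) andbT.
have /fsubsetP := exhaustion_mono exM N1N; exact.
Qed.

Lemma ler_sum_fset (R : numDomainType) (M : choiceType) (S S' : {fset M})
    (a : M -> R) : (forall n, 0 <= a n) -> (S `<=` S')%fset ->
  \sum_(n <- S) a n <= \sum_(n <- S') a n.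
Proof.
move=> a0 sSS'; rewrite (big_fsetIDcond _ (mem S) S') /=.
have -> : [fset x in S' | x \in S]%fset = S.
  apply/fsetP => x; rewrite !inE /= andbC; case: (boolP (x \in S)) => //= xS.
  exact: (fsubsetP sSS').
by rewrite lerDl sumr_ge0.
Qed.

Section msum.
Context {R : realType} {M : countType} {MN : nat -> {fset M}}.
Hypothesis exM : exhaustion MN.
Implicit Types a b : M -> R.

Lemma sum_exhaustion_homo a : (forall n, 0 <= a n) ->
  {homo (fun N => \sum_(n <- MN N) a n) : m n / (m <= n)%N >-> m <= n}.
Proof.
by move=> a0 m n mn; apply: ler_sum_fset => //; exact: exhaustion_mono.
Qed.

Lemma msum_cvg a : (forall n, 0 <= a n) ->
  (\sum_(n <- MN N) a n)%:E @[N --> \oo] --> msum MN a.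
Proof.
move=> a0; apply: ereal_nondecreasing_is_cvgn => m n mn.
by rewrite lee_fin; exact: sum_exhaustion_homo.
Qed.

Lemma sum_le_msum a N : (forall n, 0 <= a n) ->
  ((\sum_(n <- MN N) a n)%:E <= msum MN a)%E.
Proof.
move=> a0; rewrite /msum.
have hm : {homo (fun N => (\sum_(n <- MN N) a n)%:E) : m n / (m <= n)%N >-> (m <= n)%E}.
  by move=> m n mn; rewrite lee_fin; exact: sum_exhaustion_homo.
rewrite (cvg_lim _ (ereal_nondecreasing_cvgn hm))//.
by apply: ereal_sup_ubound; exists N.
Qed.

Lemma msum_le a (s : \bar R) : (forall n, 0 <= a n) ->
  (forall N, (\sum_(n <- MN N) a n)%:E <= s)%E -> (msum MN a <= s)%E.
Proof.
move=> a0 le_s; apply: lime_le; first by apply/cvg_ex; exists (msum MN a); exact: msum_cvg.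
exact: nearW.
Qed.

(** Passes from extended to real sums: later estimates and limits are carried out in [R] with this
    [s]. *)
Lemma msum_fin a : (forall n, 0 <= a n) -> (msum MN a < +oo)%E ->
  exists s : R, [/\ msum MN a = s%:E, 0 <= s,
    (forall N, \sum_(n <- MN N) a n <= s)
    & \sum_(n <- MN N) a n @[N --> \oo] --> s].
Proof.
move=> a0 afin; have s0 : (0 <= msum MN a)%E.
  by apply: le_trans (sum_le_msum 0 a0); rewrite lee_fin sumr_ge0.
have sE : msum MN a = (fine (msum MN a))%:E by rewrite fineK// ge0_fin_numE.
exists (fine (msum MN a)); split => //; first exact: fine_ge0.
- by move=> N; rewrite -lee_fin -sE; exact: sum_le_msum.
- by have := msum_cvg a0; rewrite sE => /fine_cvgP[].
Qed.

Lemma msum_dominated a b (K : R) : 0 <= K -> (forall n, 0 <= a n) ->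
  (forall n, 0 <= b n) -> (forall n, a n <= K * b n) ->
  (msum MN b < +oo)%E -> (msum MN a < +oo)%E.
Proof.
move=> K0 a0 b0 ab bfin; have [s [_ _ bs _]] := msum_fin b0 bfin.
apply: le_lt_trans (ltry (K * s)); apply: msum_le => // N.
rewrite lee_fin; apply: le_trans (ler_sum _ (fun n _ => ab n)) _.
by rewrite -mulr_sumr ler_wpM2l.
Qed.

(** Division by zero yields zero, so the terms that [tsum] omits contribute nothing; the infinite
    case is excluded by the hypothesis. *)
Lemma tsumE a b : (forall n, b n = 0 -> a n = 0) ->
  tsum MN a b = msum MN (fun n => a n / b n).
Proof.
move=> ab; rewrite /tsum; case: asboolP => [[n [an /ab]]//|_].
rewrite /msum; congr (limn _); apply/funext => N; congr (_%:E).
rewrite [RHS](bigID (fun n => b n != 0)) /= [X in _ + X]big1 ?addr0//.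
by move=> n /negPn/eqP ->; rewrite invr0 mulr0.
Qed.

Lemma tsum_den0 a b : (tsum MN a b < +oo)%E -> forall n, b n = 0 -> a n = 0.
Proof.
rewrite /tsum; case: asboolP => [_|nex _ n bn]; first by rewrite ltxx.
by apply: contrapT => an; apply: nex; exists n.
Qed.

End msum.

(** * Cauchy-Schwarz inequalities for finite sums *)

Lemma sum_mul_le_sqrt (R : realType) (I : Type) (s : seq I) (u v : I -> R) :
  \sum_(i <- s) u i * v i <=
  Num.sqrt (\sum_(i <- s) u i ^+ 2) * Num.sqrt (\sum_(i <- s) v i ^+ 2).
Proof.
rewrite -sqrtrM ?sumr_ge0// => [|i _]; last exact: sqr_ge0.
(* It suffices to bound the square of the sum, a claim without roots that suits induction on [s]. *)
apply: le_trans (ler_norm _) _; rewrite -sqrtr_sqr ler_wsqrtr//.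
elim: s => [|i s IH]; first by rewrite !big_nil expr0n mulr0.
rewrite !big_cons; move: IH.
have: 0 <= \sum_(j <- s) u j ^+ 2 by apply: sumr_ge0 => j _; exact: sqr_ge0.
have: 0 <= \sum_(j <- s) v j ^+ 2 by apply: sumr_ge0 => j _; exact: sqr_ge0.
set V := \sum_(j <- s) v j ^+ 2; set U := \sum_(j <- s) u j ^+ 2.
set W := \sum_(j <- s) _; move: (u i) (v i) => a b V0 U0 WUV.
(* the mixed term: [2 a b W <= a^2 V + b^2 U] since [W^2 <= U V] *)
suff: 2 * (a * b) * W <= a ^+ 2 * V + b ^+ 2 * U.
  by rewrite sqrrD mulrDl !mulrDr exprMn => ?; lra.
have {WUV} : `|W| <= Num.sqrt U * Num.sqrt V.
  by rewrite -sqrtrM// -sqrtr_sqr ler_wsqrtr.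
rewrite -{2}(sqr_sqrtr U0) -{2}(sqr_sqrtr V0) ler_norml => /andP[W1 W2].
move: (Num.sqrt U) (Num.sqrt V) W1 W2 => su sv W1 W2.
(* The sign of [a * b] decides whether the upper or the lower bound on [W] is needed; the rest is
   that a square is nonnegative. *)
have [ab|ab] := leP 0 (a * b).
- have := sqr_ge0 (a * sv - b * su); have := ler_wpM2l ab W2; nra.
- have := sqr_ge0 (a * sv + b * su); have := ler_wnM2l (ltW ab) W1; nra.
Qed.

Lemma weighted_cauchy_schwarz (R : realType) (I : Type) (s : seq I)
    (x g c d : I -> R) : (forall i, 0 <= c i) -> (forall i, 0 <= d i) ->
  (forall i, c i + d i = 0 -> g i = 0) ->
  \sum_(i <- s) x i * g i <=
  Num.sqrt (\sum_(i <- s) g i ^+ 2 * c i / (c i + d i) ^+ 2) *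
    Num.sqrt (\sum_(i <- s) x i ^+ 2 * c i) +
  Num.sqrt (\sum_(i <- s) g i ^+ 2 * d i / (c i + d i) ^+ 2) *
    Num.sqrt (\sum_(i <- s) x i ^+ 2 * d i).
Proof.
move=> c0 d0 gcd.
(* Each weight is split as [sqrt w * sqrt w], one root going to [g] and the other to [x]. *)
pose G (w : I -> R) i := g i * Num.sqrt (w i) / (c i + d i).
pose Y (w : I -> R) i := x i * Num.sqrt (w i).
have GE w : (forall i, 0 <= w i) ->
    \sum_(i <- s) g i ^+ 2 * w i / (c i + d i) ^+ 2 = \sum_(i <- s) G w i ^+ 2.
  by move=> w0; apply: eq_bigr => i _; rewrite /G !exprMn sqr_sqrtr// exprVn.
have YE w : (forall i, 0 <= w i) ->
    \sum_(i <- s) x i ^+ 2 * w i = \sum_(i <- s) Y w i ^+ 2.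
  by move=> w0; apply: eq_bigr => i _; rewrite /Y !exprMn sqr_sqrtr.
rewrite !GE// !YE//.
apply: le_trans (lerD (sum_mul_le_sqrt s (G c) (Y c)) (sum_mul_le_sqrt s (G d) (Y d))).
(* From here on there is equality: the products recombine to [x i * g i] term by term. Where
   [c i + d i = 0], both sides vanish because [g i = 0]. *)
rewrite -big_split /= le_eqVlt; apply/orP; left; apply/eqP.
apply: eq_bigr => i _; have [b0|b0] := eqVneq (c i + d i) 0.
  by rewrite /G b0 invr0 gcd// !(mul0r,mulr0) addr0.
have -> : G c i * Y c i + G d i * Y d i
    = x i * (g i / (c i + d i)) * (Num.sqrt (c i) ^+ 2 + Num.sqrt (d i) ^+ 2).
  by rewrite /G /Y; ring.
by rewrite !sqr_sqrtr// -mulrA divfK.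
Qed.

(** * The norm as a real number *)

Lemma norm_rnorm (R : realType) (V : normedZmodType R[i]) (v : V) :
  `|v| = (rnorm v)%:C%C.
Proof. by rewrite RRe_real// ger0_real. Qed.

Lemma rnorm_ge0 (R : realType) (V : normedZmodType R[i]) (v : V) : 0 <= rnorm v.
Proof. by rewrite -lecR -norm_rnorm; exact: normr_ge0. Qed.

Lemma rnormD (R : realType) (V : normedZmodType R[i]) (v w : V) :
  rnorm (v + w) <= rnorm v + rnorm w.
Proof. by rewrite -lecR rmorphD /= -!norm_rnorm; exact: ler_normD. Qed.

Lemma rnorm0 (R : realType) (V : normedZmodType R[i]) : rnorm (0 : V) = 0.
Proof. by rewrite /rnorm normr0. Qed.

Lemma rnorm_eq0 (R : realType) (V : normedZmodType R[i]) (v : V) :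
  (rnorm v == 0) = (v == 0).
Proof. by rewrite -[RHS]normr_eq0 norm_rnorm fmorph_eq0. Qed.

Lemma rnorm_sum (R : realType) (V : normedZmodType R[i]) (I : Type)
    (s : seq I) (F : I -> V) :
  rnorm (\sum_(i <- s) F i) <= \sum_(i <- s) rnorm (F i).
Proof.
by rewrite -lecR rmorph_sum /= -norm_rnorm (le_trans (ler_norm_sum _ _ _))//
  (eq_bigr _ (fun i _ => norm_rnorm (F i))).
Qed.

Lemma rnormM (R : realType) (a b : R[i]) : rnorm (a * b) = rnorm a * rnorm b.
Proof. by apply: complexI; rewrite rmorphM /= -!norm_rnorm normrM. Qed.

Lemma rnorm_real (R : realType) (a : R) : rnorm (a%:C%C) = `|a|.
Proof.
by apply: complexI; rewrite -norm_rnorm normc_def /= expr0n addr0 sqrtr_sqr.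
Qed.

Lemma rnorm_conj (R : realType) (a : R[i]) : rnorm (Num.conj a) = rnorm a.
Proof. by apply: complexI; rewrite -!norm_rnorm norm_conjC. Qed.

Lemma mul_conj_rnorm (R : realType) (a : R[i]) :
  a * Num.conj a = (rnorm a ^+ 2)%:C%C.
Proof. by rewrite -normCK norm_rnorm rmorphXn /=. Qed.

(** * Convergence of absolutely bounded series *)

Lemma cvg_real_complex (R : realType) (u : nat -> R) (a : R) :
  u N @[N --> \oo] --> a -> ((u N)%:C%C : R[i]^o) @[N --> \oo] --> (a%:C%C : R[i]^o).
Proof.
move=> /cvgrPdist_lt ua; apply/cvgrPdist_lt => -[e e'] /=.
(* A positive element of [R[i]] has zero imaginary part, so the tolerance is in fact real. *)
rewrite ltcE /= => /andP[/eqP -> e0]; have := ua _ e0.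
by apply: filterS => N uN; rewrite -rmorphB /= norm_rnorm rnorm_real ltcR.
Qed.

(** Writing [a = (|a| + a) - |a|] exhibits the series as a difference of two nonnegative series,
    bounded by [K + K] and by [K]. *)
Lemma abs_sum_cvg (R : realType) (M : countType) (MN : nat -> {fset M})
    (a : M -> R) (K : R) : exhaustion MN ->
  (forall N, \sum_(n <- MN N) `|a n| <= K) ->
  exists l : R, \sum_(n <- MN N) a n @[N --> \oo] --> l.
Proof.
move=> exM aK.
have cvg_nneg (w : M -> R) L : (forall n, 0 <= w n) ->
    (forall N, \sum_(n <- MN N) w n <= L) ->
    exists l : R, \sum_(n <- MN N) w n @[N --> \oo] --> l.
  move=> w0 wL; have [|l [_ _ _ wl]] := msum_fin exM w0; last by exists l.
  by apply: le_lt_trans (ltry L); apply: msum_le.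
have [l wl] := cvg_nneg _ _ (fun n => normr_ge0 (a n)) aK.
have [|N|l' wl'] := cvg_nneg (fun n => `|a n| + a n) (K + K).
- by move=> n; rewrite -lerBlDr sub0r -normrN ler_norm.
- rewrite big_split /= lerD// (le_trans _ (aK N))//.
  by apply: ler_sum => n _; exact: ler_norm.
exists (l' - l); under eq_fun => N.
  rewrite (_ : \sum_(n <- MN N) a n =
    \sum_(n <- MN N) (`|a n| + a n) - \sum_(n <- MN N) `|a n|); last first.
    by rewrite big_split /= addrAC subrr add0r.
  over.
exact: cvgB.
Qed.

Lemma complex_abs_sum_cvg (R : realType) (M : countType) (MN : nat -> {fset M})
    (z : M -> R[i]) (K : R) : exhaustion MN ->
  (forall N, \sum_(n <- MN N) rnorm (z n) <= K) ->
  exists l : R[i]^o, \sum_(n <- MN N) (z n : R[i]^o) @[N --> \oo] --> l.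
Proof.
move=> exM zK.
have part_le (g : R[i] -> R) : (forall w, `|g w| <= rnorm w) ->
    exists l : R, \sum_(n <- MN N) g (z n) @[N --> \oo] --> l.
  move=> gw; apply: (abs_sum_cvg exM) => N.
  by apply: le_trans (zK N); apply: ler_sum => n _; exact: gw.
have [|lr cr] := part_le (@complex.Re R).
  by move=> w; rewrite -lecR -norm_rnorm; exact: normc_ge_Re.
have [|li ci] := part_le (@complex.Im R).
  (* Multiplication by ['i] turns the imaginary part, up to sign, into a real part without changing
     the norm. *)
  move=> w; rewrite -normrN -ReiNIm; rewrite -lecR.
  apply: le_trans (normc_ge_Re _) _; rewrite normrM.
  by rewrite [ `|'i%C| ]normc_def /= expr0n expr1n add0r sqrtr1 mulr1 norm_rnorm.
exists ((lr%:C%C : R[i]^o) + 'i%C * li%:C%C).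
under eq_fun => N.
  rewrite (_ : \sum_(n <- MN N) (z n : R[i]^o) =
    ((\sum_(n <- MN N) complex.Re (z n))%:C%C : R[i]^o) +
    'i%C * (\sum_(n <- MN N) complex.Im (z n))%:C%C); last first.
    rewrite !rmorph_sum mulr_sumr -big_split /=; apply: eq_bigr => n _.
    exact: complexE.
  over.
apply: cvgD; first exact: cvg_real_complex.
apply: (@cvgMr R[i] nat \oo _ (fun N => (\sum_(n <- MN N) complex.Im (z n))%:C%C) 'i%C).
exact: cvg_real_complex.
Qed.

(** * Fourier expansions in an orthonormal basis *)

Section Fourier.
Context {R : realType} {H : normedModType R[i]}.
Context {ip : {dot H for @Num.conj R[i]}} {M : countType} {e : M -> H}.
Hypotheses (ipn : induces_norm ip) (oe : orthonormal_basis ip e).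

Lemma ip_sumZ (S : {fset M}) (a : M -> R[i]) (m : M) : m \in S ->
  ip (\sum_(n <- S) a n *: e n) (e m) = a m.
Proof.
move=> mS; rewrite linear_sumlz (big_fsetD1 m mS) /= linearZl_LR /=.
rewrite oe.1 eqxx mulr1 big_seq big1 ?addr0// => n.
by rewrite !inE => /andP[/negbTE nm _]; rewrite linearZl_LR /= oe.1 nm mulr0.
Qed.

Lemma ip_sumZ_out (S : {fset M}) (a : M -> R[i]) (m : M) : m \notin S ->
  ip (\sum_(n <- S) a n *: e n) (e m) = 0.
Proof.
move=> mS; rewrite linear_sumlz big_seq big1// => n nS.
by rewrite linearZl_LR /= oe.1; case: eqP nS mS => [-> ->|_]//; rewrite mulr0.
Qed.

(** Pythagoras: the combination over [S], extended by zero to [T], differs from the projection [P]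
    by a vector of the span over [T], to which [x - P] is orthogonal. *)
Lemma best_approximation (S T : {fset M}) (a : M -> R[i]) (x : H) :
  (S `<=` T)%fset ->
  `|x - \sum_(n <- T) ip x (e n) *: e n| <= `|x - \sum_(n <- S) a n *: e n|.
Proof.
move=> sST; pose a' n := if n \in S then a n else 0.
have -> : \sum_(n <- S) a n *: e n = \sum_(n <- T) a' n *: e n.
  rewrite -(big_fset_incl _ sST) /= => [|n _ nS]; last first.
    by rewrite /a' (negbTE nS) scale0r.
  by apply: eq_big_seq => n nS; rewrite /a' nS.
set P := \sum_(n <- T) _ *: _; set y := \sum_(n <- T) _ *: _.
rewrite -(@ler_pXn2r _ 2)// ?nnegrE// !ipn.
have -> : x - y = (x - P) + (P - y) by rewrite addrA subrK.
suff o : ip (x - P) (P - y) = 0.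
  rewrite (dnormD ip (x - P) (P - y)) o.
  by rewrite rmorph0 !addr0 lerDl dnorm_ge0.
rewrite /P /y -sumrB linear_sumr big_seq big1// => n nT.
rewrite -scalerBl linearZr_LR /= linearBl /= ip_sumZ//.
by rewrite subrr mulr0.
Qed.

(** Density of the span gives a finite combination close to [x]; once [MN N] contains its support,
    the Fourier sum is at least as close. *)
Lemma fourier_cvg (MN : nat -> {fset M}) (x : H) : exhaustion MN ->
  \sum_(n <- MN N) ip x (e n) *: e n @[N --> \oo] --> x.
Proof.
move=> exM; apply/cvgrPdist_lt => eps eps0.
have : closure [set x | exists (S : {fset M}) (a : M -> R[i]),
    x = \sum_(n <- S) a n *: e n] x by rewrite oe.2.
move=> /(_ _ (nbhsx_ballx x _ eps0)) [y [[S [a ->]]]].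
rewrite -ball_normE /= => xS.
have [N0 N0S] := exhaustion_eventually S exM.
exists N0 => // N /= N0N; apply: le_lt_trans xS.
by apply: best_approximation; exact: N0S.
Qed.

End Fourier.

(** * Values of closable functionals as limits along Fourier sums *)

Lemma lim_closable (K : numFieldType) (U V : normedModType K) (T : linop U V)
    (u : nat -> U) (x : U) (l : V) : closable T -> dom T x ->
  (forall N, dom T (u N)) -> u N @[N --> \oo] --> x ->
  T (u N) @[N --> \oo] --> l -> T x = l.
Proof.
move=> [S TS] Tx Tu ux Tul.
(* Both [(x, l)] and [(x, T x)] lie in the closure of the graph of [T], which is again a graph and
   hence single-valued. *)
have [_ /= Sl] : graph S (x, l).
  rewrite -TS => B Bxl.
  have := cvg_pair ux Tul; move=> /(_ _ _ _ _ Bxl) [N _ /(_ N (leqnn N)) /= BN].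
  by exists (u N, T (u N)); split; [split; first exact: Tu | exact: BN].
have [_ /= Sx] : graph S (x, T x).
  by rewrite -TS; apply: subset_closure; split.
by rewrite Sl Sx.
Qed.

Lemma linop_sum (K : numFieldType) (U V : normedModType K) (T : linop U V)
    (I : Type) (s : seq I) (a : I -> K) (e : I -> U) :
  (forall i, dom T (e i)) ->
  dom T (\sum_(i <- s) a i *: e i) /\
  T (\sum_(i <- s) a i *: e i) = \sum_(i <- s) a i *: T (e i).
Proof.
move=> Te; elim: s => [|i s [IHd IH]].
  rewrite !big_nil; split; first exact: dom0.
  (* Linearity at zero reads [T 0 = T 0 + T 0]; cancelling gives [T 0 = 0]. *)
  have := app_linear 1 (dom0 T) (dom0 T).
  by rewrite !scale1r addr0 => T0; apply: (addrI (T 0)); rewrite addr0 -T0.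
rewrite !big_cons; split; first exact: dom_linear.
by rewrite app_linear// IH.
Qed.

Lemma rnorm_lim_le (R : realType) (z : nat -> R[i]) (l : R[i]) (k : R) :
  (z N : R[i]^o) @[N --> \oo] --> (l : R[i]^o) -> (forall N, rnorm (z N) <= k) ->
  rnorm l <= k.
Proof.
move=> /cvgrPdist_lt zl zk; apply/ler_addgt0Pr => eps eps0.
have [|N _ /(_ N (leqnn N)) /= lN] := zl eps%:C%C; first by rewrite ltcR.
rewrite addrC -[l](subrK (z N)) (le_trans (rnormD _ _))// lerD// ltW//.
by rewrite -ltcR -norm_rnorm.
Qed.

(** The bound makes the values of [gf] on the Fourier sums of [x] converge; closability identifies
    the limit with [gf x], and each of these values has norm at most [k]. *)
Lemma closable_le (R : realType) (H : normedModType R[i])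
    (ip : {dot H for @Num.conj R[i]}) (M : countType) (MN : nat -> {fset M})
    (e : M -> H) (gf : linop H R[i]^o) (x : H) (k : R) :
  induces_norm ip -> orthonormal_basis ip e -> exhaustion MN ->
  closable gf -> (forall n, dom gf (e n)) -> dom gf x ->
  (forall N, \sum_(n <- MN N) rnorm (ip x (e n)) * rnorm (gf (e n)) <= k) ->
  rnorm (gf x) <= k.
Proof.
move=> ipn oe exM clgf ge gx lek.
have {}lek N : \sum_(n <- MN N) rnorm (ip x (e n) * gf (e n) : R[i]) <= k.
  by apply: le_trans (lek N); apply: ler_sum => n _; rewrite rnormM.
have [l gl] := complex_abs_sum_cvg exM lek.
have gE N := linop_sum (MN N) (fun n => ip x (e n)) ge.
rewrite (lim_closable clgf gx (fun N => (gE N).1) (@fourier_cvg _ _ _ _ _ ipn oe MN x exM) (l := l)).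
  apply: rnorm_lim_le gl _ => N; exact: le_trans (rnorm_sum _ _) (lek N).
by under eq_fun => N do rewrite (gE N).2.
Qed.

(** * Weights and seminorms *)

Section Weights.
Context {R : realType} {H H' : normedModType R[i]} {M : countType} {e : M -> H}.
Context {p : nat} {T : 'I_p.+1 -> linop H H'} {h : 'I_p.+1 -> R}.
Hypothesis h0 : forall j, 0 < h j.

Lemma weight_ge0 n : 0 <= weight e T h n.
Proof.
by apply: sumr_ge0 => j _; rewrite mulr_ge0 ?sqr_ge0// ltW.
Qed.

(** Since [1 <= h j * \sum_i (h i)^-1] for each [j]. It carries the summability assumption, made for
    unit weights, over to arbitrary ones. *)
Lemma weight1_le n :
  weight e T (fun=> 1) n <= (\sum_j (h j)^-1) * weight e T h n.
Proof.
rewrite /weight mulr_sumr; apply: ler_sum => j _.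
rewrite mul1r mulrA ler_peMl ?sqr_ge0//.
have hj : (h j)^-1 <= \sum_i (h i)^-1.
  by rewrite (bigD1 j)//= lerDl sumr_ge0// => i _; rewrite invr_ge0 ltW.
by rewrite -ler_pdivrMr// mul1r.
Qed.

(** The weighted series is a finite combination of the series bounded in [wspace], so exchanging the
    two finite sums bounds its partial sums. *)
Lemma wseminorm_lty (ip : {dot H for @Num.conj R[i]}) (MN : nat -> {fset M})
    (x : H) : exhaustion MN -> wspace ip MN e T x ->
  (msum MN (fun n => rnorm (ip x (e n)) ^+ 2 * weight e T h n)%R < +oo)%E.
Proof.
move=> exM xT.
pose a j n := rnorm (ip x (e n)) ^+ 2 * rnorm (T j (e n)) ^+ 2.
have a0 j n : 0 <= a j n by rewrite mulr_ge0 ?sqr_ge0.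
have /choice[s sP] j : exists s : R, forall N, \sum_(n <- MN N) a j n <= s.
  by have [s [_ _ ? _]] := msum_fin exM (a0 j) (xT j); exists s.
apply: le_lt_trans (ltry (\sum_j h j * s j)); apply: msum_le => //.
  by move=> n; rewrite mulr_ge0 ?sqr_ge0// weight_ge0.
move=> N; rewrite lee_fin.
under eq_bigr do rewrite mulr_sumr.
rewrite exchange_big /=; apply: ler_sum => j _.
under eq_bigr do rewrite mulrCA.
by rewrite -mulr_sumr ler_wpM2l ?sP// ltW.
Qed.

End Weights.

(** * Extremal sequences and sharpness *)

Lemma msum_finite_support (R : realType) (M : countType) (MN : nat -> {fset M})
    (S : {fset M}) (a : M -> R) : exhaustion MN ->
  (forall n, n \notin S -> a n = 0) -> msum MN a = (\sum_(n <- S) a n)%:E.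
Proof.
move=> exM aS; have [N0 N0S] := exhaustion_eventually S exM.
apply: lim_near_cst => //; exists N0 => // N /= /N0S SN; congr (_%:E).
by rewrite -(big_fset_incl _ SN)// => n _; exact: aS.
Qed.

(** Numerator and denominator both tend to [a + b], because [sqrt a * sqrt a = a], and this common
    limit is nonzero. *)
Lemma extremal_ratio (R : realType) (P Q : nat -> R) (a b : R) :
  (forall N, 0 <= P N) -> (forall N, 0 <= Q N) -> 0 <= a -> 0 <= b -> 0 < a + b ->
  P N @[N --> \oo] --> a -> Q N @[N --> \oo] --> b ->
  ((P N + Q N)%:E / (Num.sqrt a * Num.sqrt (P N) + Num.sqrt b * Num.sqrt (Q N))%:E)%E
    @[N --> \oo] --> 1%E.
Proof.
move=> P0 Q0 a0 b0 ab0 Pa Qb.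
have rab : Num.sqrt a * Num.sqrt (P N) + Num.sqrt b * Num.sqrt (Q N)
    @[N --> \oo] --> a + b.
  rewrite -{2}(sqr_sqrtr a0) -{2}(sqr_sqrtr b0) !expr2.
  by apply: cvgD; apply: cvgMr; apply: continuous_cvg => //; exact: sqrt_continuous.
have : ((P N + Q N) / (Num.sqrt a * Num.sqrt (P N) + Num.sqrt b * Num.sqrt (Q N)))%:E
    @[N --> \oo] --> 1%E.
  apply: cvg_EFin; first exact: nearW.
  rewrite -(divff (lt0r_neq0 ab0)); apply: cvgM; first exact: cvgD.
  by apply: cvgV => //; exact: lt0r_neq0.
(* Real and extended quotients agree only for a nonzero denominator, which holds eventually. *)
apply: cvg_trans; apply: near_eq_cvg.
have : \forall N \near \oo,
    0 < Num.sqrt a * Num.sqrt (P N) + Num.sqrt b * Num.sqrt (Q N).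
  by move: rab => /cvgr_gt; exact.
apply: filterS => N r0.
by rewrite inver gt_eqF.
Qed.

Lemma poweR_half_EFin (R : realType) (s : R) : 0 <= s ->
  poweR s%:E 2^-1 = (Num.sqrt s)%:E.
Proof. by move=> s0; rewrite poweR_EFin powR12_sqrt. Qed.

Lemma extremal_sharp (R : realType) (H : Type) (D : set H)
    (lhs rhs : H -> \bar R) (u : nat -> H) :
  (forall N, exists2 r : R, rhs (u N) = r%:E & 0 <= r) ->
  (forall N, 0 <= lhs (u N))%E ->
  extremal D lhs rhs u -> sharp D lhs rhs.
Proof.
move=> rhs_fin lhs0 [Du lr] k k1.
have near_gt (t : R) : t < 1 -> \forall N \near \oo,
    (t%:E < lhs (u N) / rhs (u N))%E.
  move=> t1; apply: (lr [set y | t%:E < y]%E).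
  apply: open_nbhs_nbhs; split; first exact: open_ereal_gt_ereal.
  by rewrite /= lte_fin.
(* The bound by [k] settles the case of a positive right-hand side. If that side is zero, positivity
   of the ratio is used instead, to exclude a zero left-hand side. *)
have [N _ /(_ N (leqnn N)) /= [kN N_gt0]] := filterI (near_gt _ k1) (near_gt _ ltr01).
exists (u N) => //; have [r rE r0] := rhs_fin N.
move: kN N_gt0; rewrite rE; have [->|rn0] := eqVneq r 0.
  move=> _ l0; rewrite mule0 lt_def lhs0 andbT; apply/eqP => lN.
  by rewrite lN mul0e ltxx in l0.
have rp : 0 < r by rewrite lt_def rn0.
by rewrite inver (negbTE rn0) lte_pdivlMr.
Qed.

(** * The inequality and its extremal sequence *)

Unset Implicit Arguments.

Theorem theorem3 (R : realType)
    (H : completeNormedModType R[i]) (ip : {dot H for @Num.conj R[i]})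
    (H' : completeNormedModType R[i]) (ip' : {dot H' for @Num.conj R[i]})
    (M : countType) (MN : nat -> {fset M}) (e : M -> H)
    (p q : nat) (C : 'I_p.+1 -> linop H H') (D : 'I_q.+1 -> linop H H')
    (X : normedModType R[i]) (A : linop H X) (f : {linear X -> R[i]^o}) :
  induces_norm ip -> induces_norm ip' ->
  orthonormal_basis ip e -> exhaustion MN ->
  (forall j : 'I_p.+1, closed_op (C j)) -> family_cond ip' e C ->
  (forall j : 'I_q.+1, closed_op (D j)) -> family_cond ip' e D ->
  bounded_near f (nbhs (0 : X)) ->
  (forall n : M, dom A (e n)) ->
  (exists n0 : M, f (A (e n0)) <> 0) ->
  closable (lcomp f A) ->
  (tsum MN (fun n => rnorm (f (A (e n))) ^+ 2)%R
           (fun n => weight e C (fun _ => 1) n + weight e D (fun _ => 1) n)%R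
     < +oo)%E ->
  forall (h' : 'I_p.+1 -> R) (h'' : 'I_q.+1 -> R),
  (forall j : 'I_p.+1, 0 < h' j) -> (forall j : 'I_q.+1, 0 < h'' j) ->
  let b := fun n => weight e C h' n + weight e D h'' n in
  let DB := dom A `&` (wspace ip MN e C `&` wspace ip MN e D) in
  let lhs := fun x : H => (rnorm (f (A x)))%:E in
  let rhs := fun x : H =>
    (poweR (tsum MN (fun n => rnorm (f (A (e n))) ^+ 2 * weight e C h' n)%R
                    (fun n => b n ^+ 2)%R) 2^-1%R * wseminorm ip MN e C h' x +
     poweR (tsum MN (fun n => rnorm (f (A (e n))) ^+ 2 * weight e D h'' n)%R
                    (fun n => b n ^+ 2)%R) 2^-1%R * wseminorm ip MN e D h'' x)%E in
  [/\ forall x : H, DB x -> (lhs x <= rhs x)%E,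
      sharp DB lhs rhs
    & extremal DB lhs rhs
        (fun N => tsum_vec (MN N) (fun n => Num.conj (f (A (e n)))) b e)].
Proof.
move=> ipn _ oe exM _ _ _ _ _ Ae [n0 fn0] clfA gfin h' h'' h'0 h''0 b DB lhs rhs.
pose G n := rnorm (f (A (e n))).
have G0 n : 0 <= G n by exact: rnorm_ge0.
pose c n := weight e C h' n; pose d n := weight e D h'' n.
have c0 n : 0 <= c n by exact: weight_ge0.
have d0 n : 0 <= d n by exact: weight_ge0.
have b0 n : 0 <= b n by rewrite addr_ge0.
pose b1 n := weight e C (fun=> 1) n + weight e D (fun=> 1) n.
have b10 n : 0 <= b1 n by rewrite addr_ge0// weight_ge0.
(* The sum of the two constants of [weight1_le], so that [b1 n <= k * b n]. *)
pose k := \sum_j (h' j)^-1 + \sum_j (h'' j)^-1.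
have [k'0 k''0] : 0 <= \sum_j (h' j)^-1 /\ 0 <= \sum_j (h'' j)^-1.
  by split; apply: sumr_ge0 => j _; rewrite invr_ge0 ltW.
have b1b n : b1 n <= k * b n.
  rewrite /k /b mulrDl !mulrDr.
  have := weight1_le (e := e) (T := C) h'0 n.
  have := weight1_le (e := e) (T := D) h''0 n.
  have := mulr_ge0 k'0 (d0 n); have := mulr_ge0 k''0 (c0 n).
  rewrite /b1 /c /d; lra.
have Gb1 n : b1 n = 0 -> G n ^+ 2 = 0 by move: n; exact: tsum_den0 gfin.
have Gb n : b n = 0 -> G n = 0.
  move=> bn; apply/eqP; rewrite -sqrf_eq0; apply/eqP/Gb1/le_anti.
  by rewrite b10 andbT -[0](mulr0 k) -bn.
(* With [w <= b], one has [w / b ^+ 2 <= 1 / b <= k / b1], so the assumed series dominates both sums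
   in the inequality. *)
have part_lty (w : M -> R) : (forall n, 0 <= w n) -> (forall n, w n <= b n) ->
    (msum MN (fun n => G n ^+ 2 * w n / b n ^+ 2)%R < +oo)%E.
  move=> w0 wb.
  have /(msum_dominated exM (addr_ge0 k'0 k''0)) : 
      (msum MN (fun n => G n ^+ 2 / b1 n)%R < +oo)%E.
    by move: gfin; rewrite tsumE.
  apply=> [n|n|n].
  - by rewrite divr_ge0 ?mulr_ge0 ?sqr_ge0.
  - by rewrite divr_ge0 ?sqr_ge0.
  have [bn|bn] := eqVneq (b n) 0; first by rewrite Gb// expr0n !mul0r mulr0.
  have [b1n|b1n] := eqVneq (b1 n) 0.
    by rewrite Gb1// !mul0r mulr0.
  have bp : 0 < b n by rewrite lt_def bn b0.
  have b1p : 0 < b1 n by rewrite lt_def b1n b10.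
  rewrite -mulrA [leRHS]mulrCA; apply: ler_wpM2l; first exact: sqr_ge0.
  apply: (@le_trans _ _ (b n)^-1).
    rewrite ler_pdivrMr ?exprn_gt0// expr2 mulrA mulVf// mul1r; exact: wb.
  by rewrite ler_pdivlMr// mulrC ler_pdivrMr.
have ratio0 (w : M -> R) : (forall n, 0 <= w n) ->
    forall n, 0 <= G n ^+ 2 * w n / b n ^+ 2.
  by move=> w0 n; rewrite divr_ge0 ?mulr_ge0 ?sqr_ge0.
have tsum_ratio (w : M -> R) :
    tsum MN (fun n => G n ^+ 2 * w n) (fun n => b n ^+ 2) =
    msum MN (fun n => G n ^+ 2 * w n / b n ^+ 2).
  apply: tsumE => n /eqP; rewrite sqrf_eq0 => /eqP/Gb ->.
  by rewrite expr0n mul0r.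
have cb n : c n <= b n by rewrite lerDl.
have db n : d n <= b n by rewrite lerDr.
(* [sc] and [sd] are the squares of the two constants in the inequality. *)
have [sc [scE sc0 sc_le sc_cvg]] := msum_fin exM (ratio0 c c0) (part_lty c c0 cb).
have [sd [sdE sd0 sd_le sd_cvg]] := msum_fin exM (ratio0 d d0) (part_lty d d0 db).
have rhsE x : rhs x = ((Num.sqrt sc)%:E * wseminorm ip MN e C h' x +
                       (Num.sqrt sd)%:E * wseminorm ip MN e D h'' x)%E.
  by rewrite /rhs !tsum_ratio scE sdE !poweR_half_EFin.
have rhs_fin x xc xd : 0 <= xc -> 0 <= xd ->
    msum MN (fun n => rnorm (ip x (e n)) ^+ 2 * c n) = xc%:E ->
    msum MN (fun n => rnorm (ip x (e n)) ^+ 2 * d n) = xd%:E ->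
    rhs x = (Num.sqrt sc * Num.sqrt xc + Num.sqrt sd * Num.sqrt xd)%:E.
  move=> xc0 xd0 xcE xdE.
  by rewrite rhsE /wseminorm xcE xdE !poweR_half_EFin// EFinD !EFinM.
have main x : DB x -> (lhs x <= rhs x)%E.
  move=> [Ax [xC xD]].
  have w0 (w : M -> R) : (forall n, 0 <= w n) ->
      forall n, 0 <= rnorm (ip x (e n)) ^+ 2 * w n.
    by move=> ? n; rewrite mulr_ge0 ?sqr_ge0.
  have [xc [xcE xc0 xc_le _]] := msum_fin exM (w0 c c0) (wseminorm_lty h'0 exM xC).
  have [xd [xdE xd0 xd_le _]] := msum_fin exM (w0 d d0) (wseminorm_lty h''0 exM xD).
  rewrite (rhs_fin x xc xd)// lee_fin.
  apply: (closable_le ipn oe exM clfA) => // N.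
  (* Cauchy-Schwarz is applied on the finite set [MN N]; each of the four partial sums is then at
     most its limit. *)
  apply: le_trans (weighted_cauchy_schwarz _ _ c0 d0 Gb) _.
  by apply: lerD; apply: ler_pM => //; apply: ler_wsqrtr.
pose a n := Num.conj (f (A (e n))) / (b n)%:C%C.
pose u N := \sum_(n <- MN N) a n *: e n.
have uE N : tsum_vec (MN N) (fun n => Num.conj (f (A (e n)))) b e = u N.
  rewrite /tsum_vec /u [RHS](bigID (fun n => b n != 0)) /= [X in _ + X]big1 ?addr0//.
  by move=> n /negPn/eqP bn; rewrite /a bn rmorph0 invr0 mulr0 scale0r.
have norm_a n : rnorm (a n) = G n / b n.
  by rewrite /a rnormM rnorm_conj -fmorphV rnorm_real ger0_norm// invr_ge0.
(* The squared seminorms of [u N] are exactly partial sums of the series defining [sc] and [sd]. *)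
have msum_u (w : M -> R) N :
    msum MN (fun n => rnorm (ip (u N) (e n)) ^+ 2 * w n) =
    (\sum_(n <- MN N) G n ^+ 2 * w n / b n ^+ 2)%:E.
  rewrite (msum_finite_support (S := MN N) exM) => [|n nN]; last first.
    by rewrite /u (ip_sumZ_out oe)// rnorm0 expr0n mul0r.
  congr (_%:E); apply: eq_big_seq => n nN.
  by rewrite /u (ip_sumZ oe)// norm_a exprMn exprVn mulrAC.
have msum_u_lty (w : M -> R) N :
    (msum MN (fun n => rnorm (ip (u N) (e n)) ^+ 2 * w n)%R < +oo)%E.
  by rewrite msum_u ltry.
have fu N := linop_sum (MN N) (T := lcomp f A) a Ae.
have DBu N : DB (u N).
  by split; [exact: (fu N).1 | split=> j; exact: msum_u_lty].
pose P N := \sum_(n <- MN N) G n ^+ 2 * c n / b n ^+ 2.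
pose Q N := \sum_(n <- MN N) G n ^+ 2 * d n / b n ^+ 2.
have P0 N : 0 <= P N by apply: sumr_ge0 => n _; exact: ratio0.
have Q0 N : 0 <= Q N by apply: sumr_ge0 => n _; exact: ratio0.
have rhsu N : rhs (u N) =
    (Num.sqrt sc * Num.sqrt (P N) + Num.sqrt sd * Num.sqrt (Q N))%:E.
  by apply: rhs_fin => //; exact: msum_u.
have lhsu N : lhs (u N) = (P N + Q N)%:E.
  rewrite /lhs; congr (_%:E); rewrite [f (A (u N))](fu N).2 /=.
  (* Each term equals [G n ^+ 2 / b n], and [1 / b = (c + d) / b ^+ 2] divides it between [P] and
     [Q]. *)
  have -> : \sum_(n <- MN N) a n *: f (A (e n)) = (P N + Q N)%:C%C.
    rewrite /P /Q -big_split rmorph_sum; apply: eq_bigr => n _ /=.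
    rewrite [LHS]mulrAC [X in X / _]mulrC mul_conj_rnorm -fmorph_div /=.
    congr (_%:C%C); rewrite -mulrDl -mulrDr -/(b n).
    have [bn|bn] := eqVneq (b n) 0; first by rewrite bn invr0 !mulr0 mul0r.
    by rewrite expr2 -mulrA; congr (_ * _); field.
  by rewrite rnorm_real ger0_norm// addr_ge0.
(* The index [n0] with [f (A (e n0)) <> 0] contributes a positive term, so the limit of the ratio is
   not degenerate. *)
have scd0 : 0 < sc + sd.
  have [N n0N] := exM.2 n0.
  have Gn0 : 0 < G n0 ^+ 2.
    by rewrite exprn_gt0// lt_def rnorm_eq0 G0 andbT; apply/eqP.
  have bn0 : 0 < b n0.
    rewrite lt_def b0 andbT; apply/eqP => /Gb Gn00.
    by rewrite Gn00 expr0n ltxx in Gn0.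
  apply: lt_le_trans (lerD (sc_le N) (sd_le N)).
  rewrite -big_split /= (big_fsetD1 n0)//= ltr_pwDl//.
    by rewrite -mulrDl -mulrDr -/(b n0); apply: divr_gt0; [exact: mulr_gt0 | exact: exprn_gt0].
  by apply: sumr_ge0 => n _; rewrite addr_ge0// ratio0.
have ext : extremal DB lhs rhs u.
  split=> //; under eq_fun do rewrite lhsu rhsu.
  exact: extremal_ratio.
split=> //; last by under eq_fun do rewrite uE.
apply: (extremal_sharp (u := u)) ext => N.
  rewrite rhsu; eexists; first by [].
  by rewrite addr_ge0// mulr_ge0// sqrtr_ge0.
by rewrite lhsu lee_fin addr_ge0.
Qed.
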